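(* Let $(X,\mathcal{U})$ be a $T_0$ bicomplete quasi-uniform space generated by a family $\mathcal{D}=\{d_\alpha\}_{\alpha\in A}$ of quasi-pseudometrics, and let $T\colon X\to\bigcap_{\alpha\in A}\mathscr{P}_{cb}^{(\alpha)}(X)$ be a $\mathcal{D}$-weakly contractive multivalued map. Assume in addition that $T$ is lower $\mathcal{U}^s$-hemicontinuous: for every sequence $\xi_n\to\xi$ converging in $\mathcal{U}^s$ in $X$ and every $z\in T\xi$, there is a sequence $z_n\in T\xi_n$ with $z_n\to z$ in $\mathcal{U}^s$. Then there exists $\xi^*\in X$ with $T\xi^*=\{\xi^*\}$; in particular $\xi^*$ is a $\mathcal{U}$-startpoint of $T$, a $\mathcal{U}$-endpoint of $T$, and a $\mathcal{U}$-fixed point of $T$ in the sense that $\xi^*\in T\xi^*$.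
   Context: $X$ is a non-empty set. A quasi-uniformity on $X$ is a filter $\mathcal{U}$ on $X\times X$ such that every $U\in\mathcal{U}$ contains the diagonal $\Delta_X$ and for every $U\in\mathcal{U}$ there is $V\in\mathcal{U}$ with $V\circ V\subseteq U$, where $V\circ V=\{(x,z):\exists y,\ (x,y)\in V,\ (y,z)\in V\}$. The pair $(X,\mathcal{U})$ is a quasi-uniform space. Put $U^{-1}=\{(x,y):(y,x)\in U\}$. The symmetrisation $\mathcal{U}^s$ is the uniformity generated by the entourages $U\cap U^{-1}$, $U\in\mathcal{U}$; convergence and closedness with respect to $\mathcal{U}^s$ refer to its uniform topology. $\mathcal{U}$ is $T_0$ if the preorder $\bigcap\mathcal{U}:=\bigcap_{U\in\mathcal{U}}U$ is antisymmetric. $(X,\mathcal{U})$ is bicomplete if the uniform space $(X,\mathcal{U}^s)$ is complete (every net that is Cauchy for $\mathcal{U}^s$ converges in $\mathcal{U}^s$). A quasi-pseudometric on $X$ is a function $d\colon X\times X\to[0,\infty)$ with $d(x,x)=0$ and $d(x,z)\le d(x,y)+d(y,z)$. A family $\mathcal{D}$ of quasi-pseudometrics generates the quasi-uniformity having as subbase the sets $\{(x,y):d(x,y)<\varepsilon\}$, $d\in\mathcal{D}$, $\varepsilon>0$. For $\alpha\in A$ and non-empty $P,Q\subseteq X$, set $$H_\alpha(P,Q):=\max\Big\{\sup_{p\in P}\inf_{q\in Q}d_\alpha(p,q),\ \sup_{q\in Q}\inf_{p\in P}d_\alpha(p,q)\Big\}\in[0,\infty].$$ $\mathscr{P}_{cb}^{(\alpha)}(X)$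 is the collection of non-empty $\mathcal{U}^s$-closed subsets $P\subseteq X$ with $\sup_{p,p'\in P}d_\alpha(p,p')<\infty$. A $(c)^*$-comparison function is a function $\gamma\colon[0,\infty)\to[0,\infty)$ such that (1) $\gamma$ is non-decreasing, $\gamma(0)=0$ and $0<\gamma(t)<t$ for every $t>0$; (2) for every sequence $(t_n)\subseteq(0,\infty)$, $\sum_{n=1}^\infty\gamma(t_n)<\infty$ implies $\sum_{n=1}^\infty t_n<\infty$. A multivalued map $T\colon X\to\bigcap_{\alpha\in A}\mathscr{P}_{cb}^{(\alpha)}(X)$ is $\mathcal{D}$-weakly contractive if there is a family $\{\gamma_\alpha\}_{\alpha\in A}$ of $(c)^*$-comparison functions such that for every $\xi\in X$ there exists $\eta\in T\xi$ satisfying, for every $\alpha\in A$, $$H_\alpha(\{\eta\},T\eta)\le d_\alpha(\xi,\eta)-\gamma_\alpha(d_\alpha(\xi,\eta)),\qquad H_\alpha(T\eta,\{\eta\})\le d_\alpha(\eta,\xi)-\gamma_\alpha(d_\alpha(\eta,\xi)).$$ A point $x_0$ is a $\mathcal{U}$-startpoint of a multivalued map $T$ if there is $z\in Tx_0$ with $(x_0,z)\in\bigcap\mathcal{U}$, and a $\mathcal{U}$-endpoint of $T$ if there is $z\in Tx_0$ with $(z,x_0)\in\bigcap\mathcal{U}$. *)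

(* Defs.v *)
From HB Require Import structures.
From mathcomp Require Import all_boot all_order all_algebra.
From mathcomp Require Import all_classical all_reals all_analysis.

Set Implicit Arguments.
Unset Strict Implicit.
Unset Printing Implicit Defensive.

Import Order.TTheory GRing.Theory Num.Theory.

Local Open Scope classical_set_scope.
Local Open Scope ring_scope.

(* [V \; V] below is [set xy | exists2 y, V (xy.1, y) & V (y, xy.2)], and
   [V^-1] (in relation_scope) is the converse relation. *)
Record quasi_uniformity (X : choiceType) := QuasiUniformity {
  qent : set_system (X * X);
  qent_filter : Filter qent;
  qent_diagonal : forall E, qent E -> diagonal `<=` E;
  qent_split : forall E, qent E ->
    exists2 V, qent V & (V \; V `<=` E)%relation
}.

Section symmetrisation.
Context (X : choiceType) (U : quasi_uniformity X).

(* A copy of [X], whose uniform structure is the symmetrisation of [U]. *)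
Definition symm (V : quasi_uniformity X) : Type := X.

Definition sym_entourage : set_system (X * X) :=
  filter_from (qent U) (fun E => E `&` E^-1)%relation.

Lemma sym_entourage_filter : Filter sym_entourage.
Proof.
have FU := qent_filter U.
apply: filter_from_filter; first by exists setT; exact: filterT.
move=> E F UE UF; exists (E `&` F); first exact: filterI.
by move=> [x y] [[Exy Fxy] [Eyx Fyx]]; split; split.
Qed.

Lemma sym_entourage_diagonal E : sym_entourage E -> diagonal `<=` E.
Proof.
move=> [F UF FE] [x y] /= xy; apply: FE; split.
  exact: (qent_diagonal UF).
by apply: (qent_diagonal UF); exact/esym.
Qed.

Lemma sym_entourage_inv E : sym_entourage E -> sym_entourage (E^-1)%relation.
Proof.
by move=> [F UF FE]; exists F => // -[x y] [Fxy Fyx]; apply: FE; split.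
Qed.

Lemma sym_entourage_split E : sym_entourage E ->
  exists2 F, sym_entourage F & (F \; F `<=` E)%relation.
Proof.
move=> [F UF FE]; have [V UV VF] := qent_split UF.
exists (V `&` V^-1)%relation; first by exists V.
move=> [x y] [z [Vxz Vzx] [Vzy Vyz]]; apply: FE.
by split; apply: VF; exists z.
Qed.

HB.instance Definition _ := Choice.copy (symm U) X.
HB.instance Definition _ := @isUniform.Build (symm U) sym_entourage
  sym_entourage_filter sym_entourage_diagonal sym_entourage_inv
  sym_entourage_split.

Definition qu_preorder : set (X * X) := \bigcap_(E in qent U) E.

Definition qu_T0 : Prop :=
  forall x y, qu_preorder (x, y) -> qu_preorder (y, x) -> x = y.

End symmetrisation.

Section nets.
Context (X : uniformType) (I : Type) (le : I -> I -> Prop).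

Definition directed : Prop :=
  [/\ inhabited I,
      forall i, le i i,
      forall i j k, le i j -> le j k -> le i k &
      forall i j, exists k, le i k /\ le j k].

Definition net_cauchy (u : I -> X) : Prop :=
  forall E, entourage E ->
    exists i0, forall i j, le i0 i -> le i0 j -> E (u i, u j).

Definition net_cvg (u : I -> X) (l : X) : Prop :=
  forall B, nbhs l B -> exists i0, forall i, le i0 i -> B (u i).

End nets.

Definition net_complete (X : uniformType) : Prop :=
  forall (I : Type) (le : I -> I -> Prop) (u : I -> X),
    directed le -> net_cauchy le u -> exists l, net_cvg le u l.

Definition bicomplete (X : choiceType) (U : quasi_uniformity X) : Prop :=
  net_complete (symm U).

Section quasi_pseudometrics.
Context (R : realType) (X : choiceType).
Implicit Types (d : X -> X -> R) (P Q : set X).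

Definition quasi_pseudometric d : Prop :=
  [/\ forall x y, 0 <= d x y,
      forall x, d x x = 0 &
      forall x y z, d x z <= d x y + d y z].

Definition qpm_subbase (A : Type) (D : A -> X -> X -> R) : set_system (X * X) :=
  [set E | exists a (e : R), 0 < e /\ E = [set xy | D a xy.1 xy.2 < e]].

(* The supersets of the finite intersections of members of the subbase. *)
Definition generated_by (U : quasi_uniformity X) (A : Type)
    (D : A -> X -> X -> R) : Prop :=
  qent U = filter_from (finI_from (qpm_subbase D) id) id.

Definition hausdorff d P Q : \bar R :=
  maxe (ereal_sup [set ereal_inf [set (d p q)%:E | q in Q] | p in P])
       (ereal_sup [set ereal_inf [set (d p q)%:E | p in P] | q in Q]).

Definition Pcb (U : quasi_uniformity X) d : set (set X) :=
  [set P | [/\ P !=set0,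
               closed (P : set (symm U)) &
               (ereal_sup [set (d p p')%:E | p in P & p' in P] < +oo)%E]].

End quasi_pseudometrics.

(* Functions on [0, +oo[ are encoded as functions on [R], of which only the
   values at nonnegative arguments matter. *)
Definition cstar_comparison (R : realType) (g : R -> R) : Prop :=
  [/\ forall t : R, 0 <= t -> 0 <= g t,
      forall s t : R, 0 <= s -> s <= t -> g s <= g t,
      g 0 = 0,
      forall t : R, 0 < t -> 0 < g t < t &
      forall t : nat -> R, (forall n, 0 < t n) ->
        (\sum_(0 <= n <oo) (g (t n))%:E < +oo)%E ->
        (\sum_(0 <= n <oo) (t n)%:E < +oo)%E].

Definition weakly_contractive (R : realType) (X : choiceType) (A : Type)
    (D : A -> X -> X -> R) (T : X -> set X) : Prop :=
  exists2 g : A -> R -> R, (forall a, cstar_comparison (g a)) &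
    forall xi, exists2 eta, T xi eta & forall a,
      (hausdorff (D a) [set eta] (T eta)
         <= (D a xi eta - g a (D a xi eta))%:E)%E /\
      (hausdorff (D a) (T eta) [set eta]
         <= (D a eta xi - g a (D a eta xi))%:E)%E.

Section multimaps.
Context (X : choiceType) (U : quasi_uniformity X) (T : X -> set X).

Definition lower_hemicontinuous : Prop :=
  forall (xi : nat -> symm U) (x : symm U), xi @ \oo --> x ->
  forall z : symm U, T x z ->
    exists2 zs : nat -> symm U,
      (forall n, T (xi n) (zs n)) & zs @ \oo --> z.

Definition startpoint (x : X) : Prop :=
  exists2 z, T x z & qu_preorder U (x, z).

Definition endpoint (x : X) : Prop :=
  exists2 z, T x z & qu_preorder U (z, x).

Definition fixed_point (x : X) : Prop := T x x.

End multimaps.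

(* Main.v *)
Require Import Defs.
From mathcomp Require Import all_boot all_order all_algebra.
From mathcomp Require Import all_classical all_reals all_analysis.
From mathcomp Require Import ring lra.

Import Order.TTheory GRing.Theory Num.Theory.
Import numFieldNormedType.Exports.

Local Open Scope classical_set_scope.

(** Every [q] in [T eta] satisfies [d (eta, q) <= H ({eta}, T eta)]. So an orbit
[x (n+1)] of the selection given by weak contractivity has steps
[s (n+1) <= s n - g (s n)] in both directions: [\sum g (s n)] telescopes to a
finite bound, and the [(c)*] property makes [\sum s n] finite. The orbit is thus
Cauchy and has a limit [l]. The same bound shows that the distance between
[x n] and any point of [T (x n)] tends to 0 in both directions; by lower
hemicontinuity each [z] in [T l] is a limit of such points, hence [z = l]. *)

Section comparison.
Context {R : realType}.
Local Open Scope ring_scope.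

Lemma cvg_series_bounded (s : nat -> R) (M : R) :
  (forall n, 0 <= s n) -> (forall n, series s n <= M) -> cvgn (series s).
Proof.
move=> s0 sM; apply: nondecreasing_is_cvgn.
  by apply: (@nondecreasing_series _ _ predT 0) => n _ _.
by exists M => _ [n _ <-].
Qed.

(** The (c)* property speaks only of sequences with positive terms. If some term vanishes, all later
    ones do too and the partial sums are eventually constant. *)
Lemma cstar_comparison_cvg_series {g : R -> R} (s : nat -> R) :
  cstar_comparison g -> (forall n, 0 <= s n) ->
  (forall n, s n.+1 <= s n - g (s n)) -> cvgn (series s).
Proof.
move=> [g0 _ _ _ gsum] s0 s_step.
have [s_gt0|] := pselect (forall n, 0 < s n).
  have gs_le n : \sum_(0 <= k < n) g (s k) <= s 0%N.
    (* Keeping the remainder [s n] makes the telescoping induction go through; it is dropped because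
       it is nonnegative. *)
    suff : \sum_(0 <= k < n) g (s k) <= s 0%N - s n.
      by move/le_trans; apply; rewrite lerBlDr lerDl.
    elim: n => [|n IHn]; first by rewrite big_nil subrr.
    rewrite big_nat_recr //=; have := s_step n; lra.
  have sum_g : (\sum_(0 <= n <oo) (g (s n))%:E < +oo)%E.
    apply: (@le_lt_trans _ _ (s 0%N)%:E); last exact: ltry.
    apply: lime_le; first by apply: is_cvg_nneseries => n _ _; rewrite lee_fin g0.
    by apply: nearW => n; rewrite sumEFin lee_fin.
  have := gsum _ s_gt0 sum_g.
  set S := (X in (X < _)%E) => S_lty.
  have S_ge0 : (0 <= S)%E by apply: nneseries_ge0 => n _ _; rewrite lee_fin.
  apply: (cvg_series_bounded s (fine S)) => // n.
  rewrite -lee_fin fineK ?ge0_fin_numE// /series/= -sumEFin.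
  by apply: nneseries_lim_ge => k _ _; rewrite lee_fin.
move=> /existsNP[N /negP]; rewrite -leNgt => sN_le0.
have s_eq0 m : s (N + m)%N = 0.
  elim: m => [|m IHm]; first by apply/eqP; rewrite addn0 eq_le sN_le0 s0.
  apply/eqP; rewrite addnS eq_le s0 andbT (le_trans (s_step _))//.
  by rewrite IHm sub0r oppr_le0 g0.
apply: (cvg_series_bounded s (series s N)) => // n.
have [nN|Nn] := leqP n N.
  exact: (@nondecreasing_series _ _ predT 0 (fun k _ _ => s0 k)).
rewrite /series/= (big_cat_nat _ (ltnW Nn))//= gerDl.
rewrite big_nat big1// => k /andP[Nk _].
by rewrite -(subnKC Nk) s_eq0.
Qed.

End comparison.

Section hausdorff.
Context {R : realType} {X : choiceType}.
Implicit Types (d : X -> X -> R) (P : set X).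
Local Open Scope ring_scope.

(** In the second half of the maximum the infimum ranges over the singleton, so it is [d x q]
    itself. *)
Lemma hausdorff_set1l d x P q :
  P q -> ((d x q)%:E <= hausdorff d [set x] P)%E.
Proof.
move=> Pq; rewrite /hausdorff le_max; apply/orP; right.
apply: le_trans (ereal_sup_ubound _); last by exists q => //; reflexivity.
by apply: le_ereal_inf_tmp => _ [_ -> <-].
Qed.

Lemma hausdorff_set1r d x P q :
  P q -> ((d q x)%:E <= hausdorff d P [set x])%E.
Proof.
move=> Pq; rewrite /hausdorff le_max; apply/orP; left.
apply: le_trans (ereal_sup_ubound _); last by exists q => //; reflexivity.
by apply: le_ereal_inf_tmp => _ [_ -> <-].
Qed.

End hausdorff.

Section quasi_pseudometric.
Context {R : realType} {X : choiceType}.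
Implicit Type d : X -> X -> R.
Local Open Scope ring_scope.

Lemma quasi_pseudometric_inv {d} :
  quasi_pseudometric d -> quasi_pseudometric (fun x y => d y x).
Proof. by move=> [d0 dxx dD]; split=> // x y z; rewrite addrC. Qed.

Lemma quasi_pseudometric_path {d} (x : nat -> X) m n :
  quasi_pseudometric d -> (m <= n)%N ->
  d (x m) (x n) <= \sum_(m <= k < n) d (x k) (x k.+1).
Proof.
move=> [_ dxx dD]; elim: n => [|n IHn].
  by rewrite leqn0 => /eqP ->; rewrite dxx big_nil.
rewrite leq_eqVlt => /predU1P[->|]; first by rewrite dxx big_geq.
rewrite ltnS => mn; rewrite big_nat_recr//=.
by rewrite (le_trans (dD _ (x n) _))// lerD2r IHn.
Qed.

(** Without symmetry, the forward steps control only pairs with [m <= n]; for [n <= m] the path is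
    walked back, using the conjugate of [d]. *)
Lemma cauchy_path d (x : nat -> X) : quasi_pseudometric d ->
  cvgn (series (fun n => d (x n) (x n.+1))) ->
  cvgn (series (fun n => d (x n.+1) (x n))) ->
  forall e, 0 < e -> \forall n \near (\oo, \oo), d (x n.1) (x n.2) < e.
Proof.
move=> d_qpm /cvg_cauchy/cauchy_seriesP fwd /cvg_cauchy/cauchy_seriesP bwd e e0.
have fwd' := fwd _ e0; have bwd' := bwd _ e0.
have [[P Q] /= [P_oo Q_oo] PQ] := filterI fwd' bwd'.
(* Intersecting in both coordinates allows [PQ] to be applied to [(m, n)] as well as to [(n, m)]. *)
exists (P `&` Q, P `&` Q) => [|[m n] /= [[Pm Qm] [Pn Qn]]].
  by split; exact: filterI.
have [mn|/ltnW nm] := leqP m n.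
  apply: le_lt_trans (quasi_pseudometric_path _ _ _ d_qpm mn) _.
  by have [/= /(le_lt_trans (ler_norm _))] := PQ (m, n) (conj Pm Qn).
apply: le_lt_trans
  (quasi_pseudometric_path _ _ _ (quasi_pseudometric_inv d_qpm) nm) _.
by have [_ /= /(le_lt_trans (ler_norm _))] := PQ (n, m) (conj Pn Qm).
Qed.

End quasi_pseudometric.

Section generated.
Context {R : realType} {X : choiceType} {U : quasi_uniformity X}.
Context {A : Type} {D : A -> X -> X -> R}.
Hypothesis U_gen : generated_by U D.
Local Open Scope ring_scope.

Lemma qent_qpm a e : 0 < e -> qent U [set xy | D a xy.1 xy.2 < e].
Proof.
move=> e0; rewrite U_gen; exists [set xy | D a xy.1 xy.2 < e] => //.
by apply: finI_from1; exists a, e.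
Qed.

(** Minimality of the generated filter: facts about all entourages reduce to the subbase once they
    are phrased as membership in a filter. *)
Lemma qent_sub_filter (F : set_system (X * X)) : Filter F ->
  (forall a e, 0 < e -> F [set xy | D a xy.1 xy.2 < e]) -> qent U `<=` F.
Proof.
move=> FF FD E; rewrite U_gen => -[_ [B BD <-]] /filterS; apply.
apply: filter_bigI => V /BD; rewrite inE => -[a [e [e0 ->]]].
exact: FD.
Qed.

Lemma qu_preorder_qpm x y :
  (forall a e, 0 < e -> D a x y < e) -> qu_preorder U (x, y).
Proof.
move=> Dxy E UE; suff : globally [set (x, y)] E by exact.
by apply: qent_sub_filter UE => a e e0 _ ->; exact: Dxy.
Qed.

Lemma cvg_symm_qpm (xs : nat -> symm U) (l : symm U) : xs @ \oo --> l ->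
  forall a e, 0 < e ->
  \forall n \near \oo, D a l (xs n) < e /\ D a (xs n) l < e.
Proof.
move=> /cvg_entourageP xs_l a e e0.
apply: (xs_l ([set xy | D a xy.1 xy.2 < e] `&` [set xy | D a xy.2 xy.1 < e])).
by exists [set xy | D a xy.1 xy.2 < e]; first exact: qent_qpm.
Qed.

(** The sequence is a net over [nat]. Both orders of a late pair of indices are covered by the
    hypothesis, so it yields the Cauchy property for the symmetrisation. *)
Lemma bicomplete_qpm (xs : nat -> X) : bicomplete U ->
  (forall a e, 0 < e -> \forall n \near (\oo, \oo), D a (xs n.1) (xs n.2) < e) ->
  exists l : symm U, (xs : nat -> symm U) @ \oo --> l.
Proof.
move=> U_bic xs_cauchy.
have qent_near : qent U `<=`
    ((fun n : nat * nat => (xs n.1, xs n.2)) @ (filter_prod \oo \oo)).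
  exact: qent_sub_filter.
case: (U_bic nat (fun m n => m <= n)%N xs) => [||l xs_l].
- split; first exact: (inhabits 0%N).
  + by move=> i; exact: leqnn.
  + by move=> i j k; exact: leq_trans.
  + by move=> i j; exists (maxn i j); rewrite leq_maxl leq_maxr.
- move=> E [F UF FE].
  have [[P Q] /= [[p _ Pp] [q _ Qq]] PQ] := qent_near _ UF.
  exists (maxn p q) => i j; rewrite !geq_max => /andP[pi qi] /andP[pj qj].
  apply: FE; split.
    by apply: (PQ (i, j)); split; [exact: Pp | exact: Qq].
  by apply: (PQ (j, i)); split; [exact: Pp | exact: Qq].
exists l => B /xs_l[n nB]; exists n => //= m; exact: nB.
Qed.

End generated.

Theorem theorem6p23 (R : realType) (X : pointedType) (U : quasi_uniformity X)
    (A : Type) (D : A -> X -> X -> R) (T : X -> set X)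
    (D_qpm : forall a, quasi_pseudometric (D a))
    (U_gen : generated_by U D)
    (U_T0 : qu_T0 U)
    (U_bicomplete : bicomplete U)
    (T_cb : forall x, (\bigcap_a Pcb U (D a)) (T x))
    (T_contr : weakly_contractive D T)
    (T_lhc : lower_hemicontinuous U T) :
  exists x : X,
    [/\ T x = [set x], startpoint U T x, endpoint U T x & fixed_point T x].
Proof.
have [g g_cstar sel] := T_contr.
pose f x := projT1 (cid2 (sel x)).
have Tf x : T x (f x) by rewrite /f; case: cid2.
(* Taking [q := f (f x)] gives the decrease of the orbit steps; arbitrary [q] gives the bound on
   distances to [T (f x)]. *)
have f_fwd x a q : T (f x) q ->
    (D a (f x) q <= D a x (f x) - g a (D a x (f x)))%R.
  rewrite /f; case: cid2 => /= y _ /(_ a)[H _] Tq; rewrite -lee_fin.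
  exact: le_trans (hausdorff_set1l _ _ _ _ Tq) H.
have f_bwd x a q : T (f x) q ->
    (D a q (f x) <= D a (f x) x - g a (D a (f x) x))%R.
  rewrite /f; case: cid2 => /= y _ /(_ a)[_ H] Tq; rewrite -lee_fin.
  exact: le_trans (hausdorff_set1r _ _ _ _ Tq) H.
pose x n := iter n f point.
have D_ge0 a y z : (0 <= D a y z)%R by case: (D_qpm a).
have fwd_cvg a : cvgn (series (fun n => D a (x n) (x n.+1))).
  by apply: (cstar_comparison_cvg_series _ (g_cstar a)) => // n; exact: f_fwd.
have bwd_cvg a : cvgn (series (fun n => D a (x n.+1) (x n))).
  by apply: (cstar_comparison_cvg_series _ (g_cstar a)) => // n; exact: f_bwd.
have [l x_l] : exists l : symm U, (x : nat -> symm U) @ \oo --> l.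
  apply: (bicomplete_qpm U_gen) => // a; exact: cauchy_path.
have x_Tx a q : (forall n, T (x n) (q n)) -> forall e, (0 < e)%R ->
    \forall n \near \oo, (D a (x n) (q n) < e /\ D a (q n) (x n) < e)%R.
  move=> Tq e e0.
  have [g_ge0 _ _ _ _] := g_cstar a.
  have small (s : nat -> R) : cvgn (series s) -> \forall n \near \oo, (s n < e)%R.
    move=> /cvg_series_cvg_0 s_0; near=> n; apply: le_lt_trans (ler_norm _) _.
    by near: n; exact: cvgr0_norm_lt.
  have [N _ small_N] := filterI (small _ (fwd_cvg a)) (small _ (bwd_cvg a)).
  (* Points of [T (x n.+1)] are controlled by the step from [x n] to [x n.+1], hence the shift by
     one. *)
  exists N.+1 => // -[//|n] Nn; have [fwd_n bwd_n] := small_N n Nn; split.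
    apply: le_lt_trans (f_fwd (x n) a _ (Tq n.+1)) _.
    by apply: le_lt_trans fwd_n; rewrite gerBl g_ge0.
  apply: le_lt_trans (f_bwd (x n) a _ (Tq n.+1)) _.
  by apply: le_lt_trans bwd_n; rewrite gerBl g_ge0.
have Tl_eq z : T l z -> z = l.
  move=> Tlz; have [q Tq q_z] := T_lhc _ _ x_l _ Tlz.
  (* The path [z], [q n], [x n], [l] has three legs, each below [e / 3] in both directions for large
     [n]. *)
  have Dzl a e : (0 < e)%R -> (D a z l < e /\ D a l z < e)%R.
    move=> e0; have e3 : (0 < e / 3)%R by rewrite divr_gt0.
    have [_ _ dD] := D_qpm a.
    have [n _ near_n] := filterI (cvg_symm_qpm U_gen _ _ x_l a _ e3)
      (filterI (cvg_symm_qpm U_gen _ _ q_z a _ e3) (x_Tx a q Tq _ e3)).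
    have [[lx xl] [[zq qz] [xq qx]]] := near_n n (leqnn n).
    have e3E : e = (e / 3 + e / 3 + e / 3)%R by field.
    split; rewrite e3E.
      apply: le_lt_trans (dD _ (x n) _) _; rewrite ltrD//.
      by apply: le_lt_trans (dD _ (q n) _) _; rewrite ltrD.
    apply: le_lt_trans (dD _ (q n) _) _; rewrite ltrD//.
    by apply: le_lt_trans (dD _ (x n) _) _; rewrite ltrD.
  by apply: U_T0; apply: (qu_preorder_qpm U_gen) => a e /(Dzl a)[].
(* The selected point [f l] lies in [T l], so it must be [l]. *)
have Tll : T l l by rewrite -{2}(Tl_eq _ (Tf l)).
have preorder_refl : qu_preorder U (l, l).
  by apply: (qu_preorder_qpm U_gen) => a e e0; have [_ -> _] := D_qpm a.
exists l; split=> //; [|by exists l..].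
by apply/seteqP; split=> [z /Tl_eq|_ ->].
Unshelve. all: end_near. Qed.
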